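(* Let $p$ be a prime and $q=1/p$. For integers $n\ge 1$ and $\mu\ge 1$, let $P(n,p^\mu)$ denote the probability that a random symmetric $n\times n$ matrix $A$ over $\mathbf{Z}_{p^\mu}$ satisfies $\det(A)\not\equiv 0 \pmod{p^\mu}$. Let $k=\lfloor n/2\rfloor$ and $s=\lfloor(\mu-1)/2\rfloor$. Then $$P(n,p^\mu)=\frac{\Pi_{2k}(q)}{(1-q)\,\Pi_k(q^2)}\Big((1-q^{2k+1})\,T_3(k,s)-q^\mu(1-q^n)\,T_1(k,s)\Big).$$
   Context: For a positive integer $m$, $\mathbf{Z}_m=\{1,2,\ldots,m\}$ (viewed as residues mod $m$). A random symmetric $n\times n$ matrix over $\mathbf{Z}_m$ is one whose entries $a_{ij}$, $i\le j$, are chosen independently and uniformly from $\mathbf{Z}_m$, with $a_{ji}=a_{ij}$. For $n\ge 0$, $\Pi_n(q)=\prod_{j=1}^n(1-q^j)$ (so $\Pi_0=1$). For $\beta\in\{1,3\}$, $k\ge0$, $s\ge 0$: $T_\beta(k,0\text{-case})$ is defined by $T_\beta(k,s)=1$ if $k=0$, and $T_\beta(k,s)=\sum_{j=0}^{s} q^{\beta j}\,\frac{\Pi_{k+j-1}(q^2)}{\Pi_j(q^2)\,\Pi_{k-1}(q^2)}$ if $k\ge 1$. *)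

(* Defs.v *)
From mathcomp Require Import all_boot all_order all_algebra.
Set Implicit Arguments. Unset Strict Implicit. Unset Printing Implicit Defensive.
Import Order.TTheory GRing.Theory Num.Theory.
Local Open Scope ring_scope.

Definition Pi (n : nat) (x : rat) : rat := \prod_(1 <= j < n.+1) (1 - x ^+ j).

Definition T (beta k s : nat) (q : rat) : rat :=
  if k == 0%N then 1 else
  \sum_(0 <= j < s.+1)
     q ^+ (beta * j) * Pi (k + j - 1) (q ^+ 2) / (Pi j (q ^+ 2) * Pi (k - 1) (q ^+ 2)).

(* Probability that a uniformly random symmetric n x n matrix over Z/mZ
   (entries a_ij, i <= j, independent uniform) has nonzero determinant mod m.
   Uniform choice of the upper-triangular entries is the uniform distribution
   on the set of symmetric matrices, so this is a ratio of cardinalities.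
   Intended for m >= 2 (here m = p^mu). *)
Definition symP (m n : nat) : rat :=
  (#|[set A : 'M['Z_m]_n | (A^T == A) && (\det A != 0)]|%:R)
  / (#|[set A : 'M['Z_m]_n | A^T == A]|%:R).

(* Main.v *)
(** Work over the local ring R = Z/p^N. Let A be a random symmetric matrix
    whose last d rows and columns are conditioned to lie in pR, with n free
    rows. Look at the first free row. If its diagonal entry is a unit, a Schur
    complement leaves n - 1 free rows; otherwise, if it contains a unit in
    another free column, a 2 x 2 pivot leaves n - 2 free rows; otherwise that
    row becomes one more row in pR. Once no free row is left, A = pB with B
    uniform. Unrolling this gives P(n, mu) = sum_c r(n, c) P(c, mu - c), where
    r(n, c) is the explicit probability of corank c mod p.

    For generating functions G_n = sum_mu P(n, mu) X^(mu - 1) this reads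
    G_n = sum_c r(n, c) X^c G_c. Grouping c = 2k with c = 2k + 1, the finite
    Durfee square identity yields
    (1 - X) (1 - qX) prod_(1 <= i <= n/2) (1 - q^(2i+1) X^2) G_n
      = Pi_n(q) / Pi_(n/2)(q^2) * (1 if n is odd, 1 - q^(n+1) X if n is even),
    and the generating function of the closed formula satisfies the same
    equation. *)

Require Import Defs.
From mathcomp Require Import all_boot all_fingroup all_order all_algebra.
From mathcomp Require Import ring zify.
Set Implicit Arguments. Unset Strict Implicit. Unset Printing Implicit Defensive.
Import Order.TTheory GRing.Theory Num.Theory.
Local Open Scope ring_scope.

(** Injectivity suffices: an injective self-map of a finite set is a permutation. *)
Lemma sum_stable (T : finType) (V : nmodType) (P : pred T) (h : T -> T) (F : T -> V) :
  injective h -> (forall x, P x -> P (h x)) ->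
  \sum_(x | P x) F (h x) = \sum_(x | P x) F x.
Proof.
move=> hI hP.
have E : [set h x | x in P] = [set x in P].
  apply/eqP; rewrite eqEcard card_imset // cardsE leqnn andbT.
  by apply/subsetP=> _ /imsetP[x Px ->]; rewrite inE; apply: hP.
transitivity (\sum_(x in [set h x | x in P]) F x).
  by rewrite big_imset //; apply: in2W.
by rewrite E; apply: eq_bigl => x; rewrite inE.
Qed.

(** * Finite local rings whose maximal ideal is generated by [pi] *)

Section LocalRing.
Variables (R : finComUnitRingType) (pi : R).

Definition nonunit (x : R) := x \isn't a GRing.unit.

Hypothesis nonunitP : forall x, nonunit x <-> exists y, x = pi * y.

Lemma nonunitMr x y : nonunit x -> nonunit (x * y).
Proof. by move=> /nonunitP[z ->]; apply/nonunitP; exists (z * y); rewrite mulrA. Qed.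

Lemma nonunitMl x y : nonunit x -> nonunit (y * x).
Proof. by rewrite mulrC; apply: nonunitMr. Qed.

Lemma nonunit0 : nonunit 0.
Proof. by rewrite /nonunit unitr0. Qed.

Lemma nonunitD x y : nonunit x -> nonunit y -> nonunit (x + y).
Proof.
move=> /nonunitP[u ->] /nonunitP[v ->]; apply/nonunitP.
by exists (u + v); rewrite mulrDr.
Qed.

Lemma nonunitN x : nonunit x -> nonunit (- x).
Proof. by rewrite -mulN1r; apply: nonunitMl. Qed.

Lemma nonunit_sum (T : finType) (F : T -> R) :
  (forall i, nonunit (F i)) -> nonunit (\sum_i F i).
Proof.
move=> h; apply: (big_ind (fun x => is_true (nonunit x))) => //.
- exact: nonunit0.
- exact: nonunitD.
Qed.

Lemma unitB1 x : nonunit x -> x - 1 \is a GRing.unit.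
Proof.
move=> hx; apply/negPn/negP => hy.
have := nonunitD hx (nonunitN hy).
by rewrite opprB addrCA subrr addr0 /nonunit unitr1.
Qed.

(* Symmetric matrices whose rows (hence columns) indexed by [D] are in [pi R]. *)
Definition symD m (D : pred 'I_m) : pred 'M[R]_m :=
  fun A => (A^T == A) && [forall i, forall j, D i ==> nonunit (A i j)].

Definition rowD m (D : pred 'I_m) : pred 'rV[R]_m :=
  fun b => [forall j, D j ==> nonunit (b 0 j)].

Lemma symDP m (D : pred 'I_m) (A : 'M_m) :
  reflect (A^T = A /\ forall i j, D i -> nonunit (A i j)) (symD D A).
Proof.
apply: (iffP andP) => [[/eqP sA /forallP h]|[sA h]]; split=> //.
- by move=> i j Di; have /forallP/(_ j)/implyP := h i; apply.
- exact/eqP.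
- by apply/forallP=> i; apply/forallP=> j; apply/implyP; apply: h.
Qed.

Lemma rowDP m (D : pred 'I_m) (b : 'rV_m) :
  reflect (forall j, D j -> nonunit (b 0 j)) (rowD D b).
Proof.
apply: (iffP forallP) => [h j|h j]; first by move/implyP: (h j).
exact/implyP/h.
Qed.

(** * Splitting off the first row and column *)

Definition peeled m (x : R * ('rV[R]_m * 'M[R]_m)) : 'M[R]_(1 + m) :=
  block_mx x.1%:M x.2.1 x.2.1^T x.2.2.

Lemma mx11M (c : 'M[R]_1) : (c 0 0)%:M = c.
Proof. by rewrite -mx11_scalar. Qed.

Definition dead_behead m (D : pred 'I_(1 + m)) : pred 'I_m := fun j => D (rshift 1 j).

(** By symmetry an off-diagonal entry lies in two rows, so it is a nonunit as soon as either of its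
    indices is in [D]. *)
Lemma symD_peeled m (D : pred 'I_(1 + m)) x :
  symD D (peeled x) =
  [&& D (lshift m 0) ==> nonunit x.1,
      rowD (fun j => D (lshift m 0) || D (rshift 1 j)) x.2.1 &
      symD (dead_behead D) x.2.2].
Proof.
case: x => a [b C] /=; apply/symDP/and3P => /=.
- rewrite /peeled /= tr_block_mx trmxK => -[/eq_block_mx[_ _ _ sC] h]; split.
  + apply/implyP=> /(h _ (lshift m 0)).
    by rewrite block_mxEul mxE eqxx.
  + apply/rowDP=> j /orP[Dj|Dj].
    * by have := h _ (rshift 1 j) Dj; rewrite block_mxEur.
    * by have := h _ (lshift m 0) Dj; rewrite block_mxEdl mxE.
  + apply/symDP; split=> // i j Di.
    by have := h _ (rshift 1 j) Di; rewrite block_mxEdr.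
- case=> /implyP ha /rowDP hb /symDP[sC hC]; split.
    by rewrite /peeled /= tr_block_mx trmxK sC tr_scalar_mx.
  move=> i j; rewrite -(splitK i) -(splitK j).
  case: (split i) => i' /=; case: (split j) => j' /=.
  + by rewrite !ord1 block_mxEul mxE eqxx; apply: ha.
  + by rewrite !ord1 block_mxEur => D0; apply: hb; rewrite D0.
  + by rewrite !ord1 block_mxEdl mxE => D0; apply: hb; rewrite D0 orbT.
  + by rewrite block_mxEdr; apply: hC.
Qed.

Lemma sum_peeled m (D : pred 'I_(1 + m)) (F : 'M[R]_(1 + m) -> rat) :
  \sum_(A : 'M[R]_(1+m) | symD D A) F A =
  \sum_(a | D (lshift m 0) ==> nonunit a)
   \sum_(b | rowD (fun j => D (lshift m 0) || D (rshift 1 j)) b)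
    \sum_(C | symD (dead_behead D) C) F (peeled (a, (b, C))).
Proof.
under [RHS]eq_bigr => a _ do rewrite pair_big /=.
rewrite pair_big /= (reindex_onto (@peeled m) (fun A =>
  (ulsubmx A 0 0, (ursubmx A, drsubmx A)))) /=; last first.
  move=> A /symDP[sA _]; rewrite /peeled /= mx11M.
  by rewrite trmx_ursub sA submxK.
apply: eq_big => [[a [b C]]|[a [b C]] _] //=.
rewrite symD_peeled /= /peeled /= block_mxKul block_mxKur block_mxKdr mxE eqxx.
by rewrite mulr1n eqxx andbT.
Qed.

(** Block elimination. Keeping [c] independent of [b] also covers the row-swapped matrix in
    [sum_pivot_schur]. *)
Lemma det_schur m (a : R) (b : 'rV[R]_m) (c : 'cV_m) (K : 'M_m) :
  a \is a GRing.unit ->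
  \det (block_mx a%:M b c K : 'M_(1 + m)) = a * \det (K - a^-1 *: (c *m b)).
Proof.
move=> ua.
have -> : block_mx a%:M b c K =
  block_mx 1%:M 0 (a^-1 *: c) 1%:M *m block_mx a%:M b 0 (K - a^-1 *: (c *m b))
    :> 'M_(1 + m).
  rewrite mulmx_block !mul1mx !mul0mx !addr0 -!scalemxAl addrC subrK.
  by rewrite mul_mx_scalar scalerA mulVr // scale1r.
by rewrite det_mulmx det_lblock det_ublock !det1 !mul1r det_scalar1.
Qed.

(** * Determinant sums, congruences and pivots *)

Definition unit_invariant (f : R -> rat) :=
  forall u x, u \is a GRing.unit -> f (u * x) = f x.

Definition mass m (D : pred 'I_m) (f : R -> rat) : rat :=
  \sum_(A : 'M[R]_m | symD D A) f (\det A).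

Lemma mass_eq m (D D' : pred 'I_m) f : D =1 D' -> mass D f = mass D' f.
Proof.
move=> e; apply: eq_bigl => A; rewrite /symD; congr (_ && _).
by apply: eq_forallb => i; apply: eq_forallb => j; rewrite e.
Qed.

(** In row [k] of [V^T C V] with [D k], every term [V i k * C i j * V j l] is a nonunit: because of
    [C i j] if [D i], because of [V i k] otherwise. So the congruence permutes the admissible
    matrices. *)
Lemma sum_symD_congr m (D : pred 'I_m) (V : 'M[R]_m) (F : 'M[R]_m -> rat) :
  V \in unitmx -> (forall i k, ~~ D i -> D k -> nonunit (V i k)) ->
  \sum_(C : 'M[R]_m | symD D C) F (V^T *m C *m V) =
  \sum_(C : 'M[R]_m | symD D C) F C.
Proof.
move=> uV pV; apply: (@sum_stable _ _ _ (fun C => V^T *m C *m V)).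
  move=> A B; have uVT : V^T \in unitmx by rewrite unitmx_tr.
  move/(congr1 (mulmx^~ (invmx V))); rewrite !mulmxK //.
  by move/(congr1 (mulmx (invmx V^T))); rewrite !mulKmx.
move=> C sC; have [sCT hC] := symDP _ _ sC; apply/symDP; split.
  by rewrite !trmx_mul trmxK sCT mulmxA.
move=> k l Dk; rewrite mxE; apply: nonunit_sum => j; apply: nonunitMr.
rewrite mxE; apply: nonunit_sum => i; rewrite mxE.
have [Di|nDi] := boolP (D i); first exact/nonunitMl/hC.
exact/nonunitMr/pV.
Qed.

Lemma sum_symD_shift m (D : pred 'I_m) (B : 'M[R]_m) (F : 'M[R]_m -> rat) :
  symD D B ->
  \sum_(C : 'M[R]_m | symD D C) F (C + B) =
  \sum_(C : 'M[R]_m | symD D C) F C.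
Proof.
move=> /symDP[sB hB]; apply: (@sum_stable _ _ _ (fun C => C + B)).
  by move=> A A' /addIr.
move=> C /symDP[sC hC]; apply/symDP; split; first by rewrite linearD /= sC sB.
by move=> i j Di; rewrite mxE; apply: nonunitD; [apply: hC|apply: hB].
Qed.

(** Schur complement corrections have this shape, so [sum_symD_shift] can absorb them. *)
Lemma symD_rank1 m (D : pred 'I_m) (s : R) (b : 'rV[R]_m) :
  rowD D b -> symD D (s *: (b^T *m b)).
Proof.
move=> /rowDP hb; apply/symDP; split.
  by rewrite linearZ /= trmx_mul trmxK.
move=> i j Di; rewrite mxE mxE; apply/nonunitMl/nonunit_sum => k.
by rewrite mxE ord1; apply/nonunitMr/hb.
Qed.

(** Permuting rows and columns together multiplies the determinant by the square of a sign. *)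
Lemma mass_perm m (D : pred 'I_m) (s : 'S_m) f :
  mass (fun i => D (s i)) f = mass D f.
Proof.
rewrite /mass [LHS](reindex_onto (fun A : 'M[R]_m => row_perm s (col_perm s A))
  (fun A => row_perm s^-1%g (col_perm s^-1%g A))) /=; last first.
  by move=> A _; apply/matrixP=> i j; rewrite !mxE !permK.
apply: eq_big => [A|A _].
  have -> : (row_perm s^-1 (col_perm s^-1 (row_perm s (col_perm s A))) == A)%g.
    by apply/eqP/matrixP=> i j; rewrite !mxE !permKV.
  rewrite andbT; apply/symDP/symDP => -[sA hA]; split.
  - apply/matrixP=> i j; move/matrixP/(_ (s^-1%g i) (s^-1%g j)): sA.
    by rewrite !mxE !permKV.
  - by move=> i j Di; have := hA (s^-1%g i) (s^-1%g j); rewrite !mxE !permKV; apply.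
  - by apply/matrixP=> i j; move/matrixP/(_ (s i) (s j)): sA; rewrite !mxE.
  - by move=> i j Di; rewrite !mxE; apply: hA.
congr f; rewrite row_permE col_permE !det_mulmx mulrCA -det_mulmx -perm_mxM.
by rewrite mulgV perm_mx1 det1 mulr1.
Qed.

(* The congruence by [diag(1, W)]. *)
Lemma det_peeled_congr m (a : R) (e : 'rV[R]_m) (C W : 'M[R]_m) :
  \det (peeled (a, (e *m W, W^T *m C *m W))) =
  (\det W * \det W) * \det (peeled (a, (e, C))).
Proof.
have -> : peeled (a, (e *m W, W^T *m C *m W)) =
   (block_mx 1%:M 0 0 W)^T *m peeled (a, (e, C)) *m block_mx 1%:M 0 0 W.
  rewrite /peeled /= tr_block_mx !mulmx_block !trmx0 tr_scalar_mx.
  by rewrite !mul0mx !mulmx0 !addr0 !add0r !mul1mx !mulmx1 trmx_mul.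
by rewrite !det_mulmx det_tr det_lblock det1 mul1r mulrAC.
Qed.

(** This is the identity with row [j] replaced by [b]; the inverse is given by the Sherman-Morrison
    formula. *)
Lemma unit_mx_delta m (b : 'rV[R]_m) j : b 0 j \is a GRing.unit ->
  (1%:M + delta_mx j 0 *m (b - delta_mx 0 j) : 'M_m) \in unitmx.
Proof.
move=> ub; set d := delta_mx j 0; set u := b - _.
have ud : u *m d = (b 0 j - 1)%:M.
  rewrite -colE [LHS]mx11_scalar; congr _%:M.
  by rewrite !mxE !eqxx.
have dud x : (d *m u) *m (d *m x) = (b 0 j - 1) *: (d *m x) :> 'M_m.
  by rewrite mulmxA -(mulmxA d) ud mul_mx_scalar -scalemxAl.
suff /mulmx1_unit[] : (1%:M + d *m u) *m (1%:M - (b 0 j)^-1 *: (d *m u)) = 1%:M by [].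
rewrite mulmxBr mulmx1 mulmxDl mul1mx -scalemxAr dud scalerA.
rewrite -addrA -[RHS]addr0; congr (_ + _); rewrite -scalerDl.
rewrite -[X in X - _]scale1r -scalerBl.
by rewrite mulrBr mulr1 mulVr // addrCA subrr addr0 subrr scale0r.
Qed.

(** Since [b = e_j W] for the matrix [W] of [unit_mx_delta], congruence by [diag(1, W)] trades [b]
    for [e_j]. Its row [j] is admissible because [b] is a nonunit on [D]. *)
Lemma sum_pivot m (D : pred 'I_m) a (b : 'rV[R]_m) j f : unit_invariant f ->
  rowD D b -> b 0 j \is a GRing.unit ->
  \sum_(C : 'M[R]_m | symD D C) f (\det (peeled (a, (b, C)))) =
  \sum_(C : 'M[R]_m | symD D C) f (\det (peeled (a, (delta_mx 0 j, C)))).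
Proof.
move=> uf /rowDP hb ub; set W := 1%:M + delta_mx j 0 *m (b - delta_mx 0 j).
have uW : W \in unitmx by apply: unit_mx_delta.
rewrite -(sum_symD_congr (V := W)) //.
  apply: eq_bigr => C _.
  have -> : b = delta_mx 0 j *m W.
    rewrite mulmxDr mulmx1 mulmxA mul_delta_mx.
    rewrite (_ : delta_mx 0 0 = 1%:M); last first.
      by apply/matrixP=> i k; rewrite !mxE !ord1.
    by rewrite mul1mx addrC subrK.
  by rewrite det_peeled_congr uf // unitrM -!unitmxE uW.
have nDj : ~~ D j by apply/negP => /hb; rewrite /nonunit ub.
move=> i k nDi Dk; rewrite mxE; apply: nonunitD.
  rewrite mxE; case: eqP => [e|_]; last exact: nonunit0.
  by rewrite -e (negPf nDi) in Dk.
rewrite mxE; apply: nonunit_sum => l; apply: nonunitMl; rewrite mxE.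
apply: nonunitD; first by rewrite ord1; apply: hb.
rewrite !mxE; case: (k =P j) => [e|_]; last by rewrite andbF oppr0; exact: nonunit0.
by rewrite e (negPf nDj) in Dk.
Qed.

Lemma sum_pivot_swap m (D : pred 'I_m) a i j f : unit_invariant f ->
  ~~ D i -> ~~ D j ->
  \sum_(C : 'M[R]_m | symD D C) f (\det (peeled (a, (delta_mx 0 j, C)))) =
  \sum_(C : 'M[R]_m | symD D C) f (\det (peeled (a, (delta_mx 0 i, C)))).
Proof.
move=> uf Di Dj; have uW := unitmx_perm R (tperm i j).
rewrite -(sum_symD_congr (V := perm_mx (tperm i j))) //.
  apply: eq_bigr => C _.
  have -> : delta_mx 0 j = delta_mx 0 i *m perm_mx (tperm i j) :> 'rV[R]_m.
    by rewrite -rowE; apply/rowP=> k; rewrite !mxE tpermL eqxx eq_sym.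
  by rewrite det_peeled_congr uf // unitrM -!unitmxE uW.
move=> k l nDk Dl; rewrite !mxE; case: eqP => [e|_]; last exact: nonunit0.
move: nDk; rewrite -(tpermK i j k) e.
case: tpermP => [lE|lE|_ _]; last by rewrite Dl.
  by rewrite lE (negPf Di) in Dl.
by rewrite lE (negPf Dj) in Dl.
Qed.

(* Eliminates the pivot block [[a, 1], [1, c]], whose determinant [ac - 1] is a
   unit since [a] is not. *)
Lemma sum_pivot_schur m (D : pred 'I_m) a c (w : 'rV[R]_m) f :
  unit_invariant f -> nonunit a -> rowD D w ->
  \sum_(K : 'M[R]_m | symD D K)
     f (\det (peeled (a, (row_mx 1%:M 0, peeled (c, (w, K)))))) = mass D f.
Proof.
move=> uf ha hw.
have u1 : 1 - c * a \is a GRing.unit.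
  by rewrite -opprB unitrN; apply/unitB1/nonunitMl.
(* Elimination adds [a / (1 - c * a)] times [w^T w] to the remaining block; the shift cancels this
   in advance. *)
rewrite /mass -(sum_symD_shift _ (symD_rank1 (- a / (1 - c * a)) hw)).
apply: eq_bigr => K _; set K' := K + _.
(* [P] swaps the first two rows, which brings the unit 1 to the corner; then [det_schur] applies
   twice. *)
pose P : 'M[R]_(1 + (1 + m)) :=
  block_mx 0 (row_mx 1%:M 0) (col_mx 1%:M 0) (block_mx 0 0 0 1%:M).
have PP : P *m P = 1%:M.
  rewrite /P !mulmx_block !mul0mx !mulmx0 !mul_row_block !mul_block_col !mul_row_col.
  rewrite !mul_col_row ?mulmx0 !mul0mx !mul1mx !addr0 !add0r.
  rewrite add_block_mx !addr0 add0r row_mx0 col_mx0.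
  by rewrite [RHS]scalar_mx_block (@scalar_mx_block _ 1 m).
have /mulmx1_unit[uP _] := PP.
rewrite -(uf (\det P)) -?unitmxE // -det_mulmx.
have -> : P *m peeled (a, (row_mx 1%:M 0, peeled (c, (w, K')))) =
  block_mx 1%:M (row_mx c%:M w) (col_mx a%:M 0) (block_mx 1%:M 0 w^T K').
  rewrite /P /peeled /= tr_row_mx trmx1 trmx0.
  rewrite !mulmx_block !mul_row_block !mul_block_col !mul_row_col.
  rewrite !mul_col_row.
  rewrite !mul0mx !mul1mx ?addr0 ?add0r.
  by rewrite mul_col_mx mul1mx mul0mx add_block_mx col_mx0 !addr0 !add0r.
rewrite det_schur ?unitr1 // mul1r invr1 scale1r mul_col_row !mul0mx.
rewrite opp_block_mx add_block_mx !mul_scalar_mx !subr0 sub0r.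
rewrite scale_scalar_mx -raddfB /= (mulrC a) det_schur // uf //; congr (f (\det _)).
rewrite /K' mulmxN scalerN opprK -scalemxAr scalerA -addrA -[RHS]addr0; congr (_ + _).
by rewrite -scalerDl mulNr (mulrC a) addNr scale0r.
Qed.

(** * Counting rows with prescribed nonunits *)

Definition ring_count : rat := \sum_(a : R) 1.
Definition nonunit_count : rat := \sum_(a | nonunit a) 1.
Definition row_count m (D : pred 'I_m) : rat := \sum_(b | rowD D b) 1.

Lemma sum_cst (I : finType) (P : pred I) (c : rat) :
  \sum_(i | P i) c = (\sum_(i | P i) 1) * c.
Proof. by rewrite mulr_suml; apply: eq_bigr => i _; rewrite mul1r. Qed.

Lemma row_countE m (D : pred 'I_m) :
  row_count D = \prod_j (if D j then nonunit_count else ring_count).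
Proof.
transitivity (\prod_j \sum_(a | D j ==> nonunit a) (1 : rat)); last first.
  by apply: eq_bigr => j _; case: (D j).
rewrite bigA_distr_big_dep.
rewrite (reindex (fun b : 'rV[R]_m => [ffun j => b 0 j])) /=; last first.
  exists (fun g : {ffun 'I_m -> R} => \row_j g j) => b _.
    by apply/rowP=> j; rewrite mxE ffunE.
  by apply/ffunP=> j; rewrite ffunE mxE.
apply: eq_big => [b|b _]; last by rewrite big1_eq.
by apply: eq_forallb => j; rewrite ffunE.
Qed.

(** Dead indices are those confined to [pi R]; the first [n] are live. By [mass_perm] only the
    number of live ones matters. *)
Definition dead_tail m n : pred 'I_m := fun j => (n <= j)%N.

Lemma row_count_tail m n : (n <= m)%N ->
  row_count (@dead_tail m n) = ring_count ^+ n * nonunit_count ^+ (m - n).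
Proof.
move=> lnm; rewrite row_countE.
rewrite -(big_mkord xpredT (fun j => if (n <= j)%N then nonunit_count else ring_count)).
rewrite (big_cat_nat (n := n)) //=; congr (_ * _).
  rewrite (eq_big_nat _ _ (F2 := fun=> ring_count)) => [|i /andP[_ h]].
    by rewrite prodr_const_nat subn0.
  by rewrite leqNgt h.
rewrite (eq_big_nat _ _ (F2 := fun=> nonunit_count)) => [|i /andP[h _]].
  by rewrite prodr_const_nat.
by rewrite h.
Qed.

Lemma row_count_all m (D : pred 'I_m) : (forall j, D j) -> row_count D = nonunit_count ^+ m.
Proof.
move=> h; rewrite row_countE (eq_bigr (fun=> nonunit_count)) => [|j _]; last by rewrite h.
by rewrite prodr_const card_ord.
Qed.

(** * Recursion on the number of live rows *)

Definition tail_mass m n f := mass (@dead_tail m n) f.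

(** When the first row dies, its index stands before the live ones; exchanging 0 and [n] restores
    the standard order. *)
Lemma mass_head_tail m n f : (n <= m)%N ->
  mass (fun i : 'I_(1 + m) => (i == 0 :> nat) || (n < i)%N) f = tail_mass m.+1 n f.
Proof.
move=> lnm; have ln : (n < 1 + m)%N by [].
rewrite /tail_mass -(mass_perm _ (tperm (0 : 'I_m.+1) (Ordinal ln))).
apply: mass_eq => i; rewrite /dead_tail; case: tpermP => [->|->|n0 nn] /=.
- by rewrite leqnn.
- by rewrite ltnn orbF leqn0.
- have -> : (i == 0 :> nat) = false by apply/negP=> /eqP i0; apply: n0; apply: val_inj.
  have ni : n <> i by move=> ni; apply: nn; apply: val_inj.
  by rewrite (leq_eqVlt n) (introF eqP ni).
Qed.

(** Once the pivot is moved to the first live column, the second diagonal entry [c] and the rest [w]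
    of its row are eliminated whatever their values, and contribute the two counts. *)
Lemma sum_symD_nonunit_pivot m n a (b : 'rV[R]_m.+1) f : unit_invariant f ->
  nonunit a -> rowD (@dead_tail m.+1 n.+1) b -> ~~ rowD xpredT b ->
  \sum_(C : 'M[R]_m.+1 | symD (@dead_tail m.+1 n.+1) C) f (\det (peeled (a, (b, C)))) =
  ring_count * row_count (@dead_tail m n) * tail_mass m n f.
Proof.
move=> uf na hb; rewrite /rowD negb_forall => /existsP[j]; rewrite implyTb negbK => ub.
rewrite (sum_pivot _ _ hb ub) // (@sum_pivot_swap _ _ _ 0) //; last first.
  by apply/negP => Dj; have := rowDP _ _ hb j Dj; rewrite /nonunit ub.
have e1 : delta_mx 0 0 = row_mx 1%:M 0 :> 'M[R]_(1, 1 + m).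
  by apply/matrixP=> i k; rewrite !mxE; case: split_ordP => l ->; rewrite !mxE !ord1.
rewrite (@sum_peeled m) e1 -mulrA -sum_cst; apply: eq_bigr => c _.
rewrite -sum_cst; apply: eq_bigr => w hw.
exact: sum_pivot_schur.
Qed.

(* The three terms: the corner is a unit; the corner is not a unit but the first
   row contains one; the whole first row consists of nonunits. *)
Lemma tail_massS m n f : (n <= m)%N -> unit_invariant f ->
  tail_mass m.+1 n.+1 f =
    (ring_count - nonunit_count) * row_count (@dead_tail m n) * tail_mass m n f
    + nonunit_count * (row_count (@dead_tail m n) - nonunit_count ^+ m)
      * (ring_count * row_count (@dead_tail m.-1 n.-1) * tail_mass m.-1 n.-1 f)
    + tail_mass m.+1 n f.
Proof.
move=> lnm uf; rewrite {1}/tail_mass /mass (@sum_peeled m).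
rewrite (bigID nonunit) /= addrC -addrA; congr (_ + _).
  have -> : ring_count - nonunit_count = \sum_(a | ~~ nonunit a) 1.
    by rewrite /ring_count (bigID nonunit) /= addrC addrK.
  rewrite -mulrA -sum_cst; apply: eq_bigr => a ua.
  rewrite -sum_cst; apply: eq_bigr => b hb.
  have {}ua : a \is a GRing.unit by rewrite /nonunit negbK in ua.
  (* The shift by the rank one correction turns the Schur complement back into [C]. *)
  rewrite -(sum_symD_shift _ (symD_rank1 a^-1 hb)); apply: eq_bigr => C _.
  by rewrite /peeled det_schur // uf // addrK.
rewrite -mass_head_tail // /mass (@sum_peeled m) -mulrA -sum_cst -big_split /=.
apply: eq_bigr => a na.
rewrite (bigID (rowD xpredT)) /= addrC; congr (_ + _); last first.
  apply: eq_big => [b|b _]; last exact: eq_bigl.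
  apply/andP/idP => [[_ //]|hb]; split=> //.
  by apply/rowDP=> j _; apply: (rowDP _ _ hb).
have -> : row_count (@dead_tail m n) - nonunit_count ^+ m =
    \sum_(b | rowD (@dead_tail m n) b && ~~ rowD xpredT b) 1.
  rewrite -(row_count_all (D := xpredT)) // /row_count (bigID (rowD xpredT)) /= addrC.
  rewrite -addrA -[RHS]addr0; congr (_ + _); apply/eqP; rewrite subr_eq0; apply/eqP.
  apply: eq_bigl => b; apply/andP/idP => [[_ //]|hb]; split=> //.
  by apply/rowDP=> j _; apply: (rowDP _ _ hb).
rewrite -sum_cst; apply: eq_bigr => b /andP[hb nb].
(* If [m] or [n] is 0, no column is live and the row cannot contain a unit; otherwise [m.-1] and
   [n.-1] are genuine predecessors. *)
case: m n lnm b hb nb => [|m] [|n] //= lnm b hb nb.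
- by case/negP: nb; apply/rowDP => -[].
- by case/negP: nb; apply/rowDP => j _; apply: (rowDP _ _ hb).
exact: sum_symD_nonunit_pivot.
Qed.

Lemma tail_mass1_live m n : (n <= m)%N ->
  tail_mass m.+1 n.+1 (fun=> 1) = ring_count * row_count (@dead_tail m n) * tail_mass m n (fun=> 1).
Proof.
move=> lnm; rewrite {1}/tail_mass /mass (@sum_peeled m) -mulrA -sum_cst.
by apply: eq_bigr => a _; rewrite -sum_cst; apply: eq_bigr.
Qed.

Lemma tail_mass1_dead m n : (n <= m)%N ->
  tail_mass m.+1 n (fun=> 1) = nonunit_count ^+ m.+1 * tail_mass m n (fun=> 1).
Proof.
move=> lnm; rewrite -mass_head_tail // /mass (@sum_peeled m) exprS -mulrA -sum_cst.
apply: eq_bigr => a _; rewrite -(row_count_all (D := xpredT)) // -sum_cst.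
by apply: eq_bigr.
Qed.

Lemma nonunit_count_neq0 : nonunit_count != 0.
Proof.
rewrite /nonunit_count (bigD1 0) /= ?nonunit0 //.
by rewrite lt0r_neq0 // ltr_pwDl // sumr_ge0.
Qed.

Lemma ring_count_neq0 : ring_count != 0.
Proof.
by rewrite /ring_count (bigD1 0) //= lt0r_neq0 // ltr_pwDl // sumr_ge0.
Qed.

Lemma tail_mass1_neq0 m n : tail_mass m n (fun=> 1) != 0.
Proof.
rewrite /tail_mass /mass (bigD1 0) /=; last first.
  apply/symDP; split=> [|i j _]; first by rewrite trmx0.
  by rewrite mxE; apply: nonunit0.
by rewrite lt0r_neq0 // ltr_pwDl // sumr_ge0.
Qed.

(** The expectation of [f (\det A)] given that the last [m - n] rows lie in [pi R]. *)
Definition avg m n f := tail_mass m n f / tail_mass m n (fun=> 1).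
Definition nonunit_ratio := nonunit_count / ring_count.

(** The coefficients are the probabilities of the three outcomes of [tail_massS], each of the [n.+1]
    live entries of the first row being a nonunit with probability [nonunit_ratio]. *)
Lemma avgS m n f : (n <= m)%N -> unit_invariant f ->
  avg m.+1 n.+1 f = (1 - nonunit_ratio) * avg m n f
    + nonunit_ratio * (1 - nonunit_ratio ^+ n) * avg m.-1 n.-1 f
    + nonunit_ratio ^+ n.+1 * avg m.+1 n f.
Proof.
move=> lnm uf; rewrite /avg tail_massS // tail_mass1_live // tail_mass1_dead //.
have r0 := ring_count_neq0; have i0 := nonunit_count_neq0.
have N0 := tail_mass1_neq0 m n.
rewrite /nonunit_ratio row_count_tail //.
have im : nonunit_count ^+ m = nonunit_count ^+ n * nonunit_count ^+ (m - n).
  by rewrite -exprD subnKC.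
rewrite !exprS im; have Nmn : nonunit_count ^+ (m - n) != 0 by rewrite expf_neq0.
move: lnm N0 im Nmn; case: n => [|n].
  move=> _ N0 _ Nmn; rewrite !expr0 !mulr1 !mul1r !subrr !mulr0 !mul0r !addr0.
  by field; rewrite r0 N0 i0 Nmn.
case: m => // m lnm /=; rewrite tail_mass1_live // row_count_tail // subSS => N0 _ Nmn.
rewrite !exprS !expr_div_n.
move: N0; rewrite !mulf_eq0 !negb_or => /andP[/andP[_ /andP[N1 _]] N2].
have N3 : nonunit_count ^+ n != 0 by rewrite expf_neq0.
by field; rewrite r0 N1 N2 N3 i0 Nmn.
Qed.

(* [B |-> pi B] maps symmetric matrices onto those with entries in [pi R], with
   fibres of constant size. *)
Lemma sum_sym_scale m (F : 'M[R]_m -> rat) :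
  \sum_(B : 'M[R]_m | B^T == B) F (pi *: B) =
  (\sum_(K : 'M[R]_m | (K^T == K) && (pi *: K == 0)) 1)
    * \sum_(A : 'M[R]_m | symD xpredT A) F A.
Proof.
rewrite (partition_big (fun B => pi *: B) (@symD m xpredT)) /=; last first.
  move=> B /eqP sB; apply/symDP; split; first by rewrite linearZ /= sB.
  by move=> i j _; rewrite mxE; apply/nonunitP; exists (B i j).
rewrite mulr_sumr; apply: eq_bigr => A /symDP[sA hA].
(* A preimage under multiplication by [pi], chosen as a function of the entry alone, so that [B0]
   inherits the symmetry of [A]. *)
pose g (x : R) := odflt 0 [pick y | x == pi * y].
pose B0 := map_mx g A.
have pB0 : pi *: B0 = A.
  apply/matrixP=> i j; rewrite !mxE /g; case: pickP => [y /eqP //|n0].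
  have /nonunitP[y ey] := hA i j isT; by move: (n0 y); rewrite ey eqxx.
have sB0 : B0^T = B0 by apply/matrixP=> i j; rewrite !mxE -[in RHS]sA mxE.
rewrite mulr_suml (reindex (fun K => K + B0)) /=; last first.
  by exists (fun B => B - B0) => K _; rewrite ?addrK ?subrK.
apply: eq_big => [K|K /andP[_ /eqP->]]; last by rewrite mul1r.
rewrite linearD /= sB0 scalerDr pB0 (inj_eq (addIr _)); congr (_ && _).
by rewrite -[X in _ == X]add0r (inj_eq (addIr _)).
Qed.

(** A matrix with all rows dead is [pi *: B], and [\det (pi *: B) = pi ^+ m * \det B]; the fibre
    size [k] cancels in the quotient. *)
Lemma avg_dead m f : avg m 0 f = avg m m (fun x => f (pi ^+ m * x)).
Proof.
have mD0 F : tail_mass m 0 F = \sum_(A : 'M[R]_m | symD xpredT A) F (\det A) by [].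
have mDm F : tail_mass m m F = \sum_(A : 'M[R]_m | A^T == A) F (\det A).
  apply: eq_bigl => A; apply/symDP/eqP => [[]//|sA]; split=> // i j.
  by rewrite /dead_tail leqNgt ltn_ord.
set k := \sum_(K : 'M[R]_m | (K^T == K) && (pi *: K == 0)) (1 : rat).
have H F : tail_mass m m (fun x => F (pi ^+ m * x)) = k * tail_mass m 0 F.
  by rewrite mDm mD0 -sum_sym_scale; apply: eq_bigr => B _; rewrite detZ.
have k0 : k != 0.
  rewrite /k (bigD1 0) /= ?trmx0 ?scaler0 ?eqxx //.
  by rewrite lt0r_neq0 // ltr_pwDl // sumr_ge0.
rewrite /avg H (H (fun=> 1)); field.
by rewrite k0 tail_mass1_neq0.
Qed.

End LocalRing.

(** * Products [Pi] and index arithmetic *)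

Lemma Pi0 x : Pi 0 x = 1.
Proof. by rewrite /Pi big_geq. Qed.

Lemma PiS n x : Pi n.+1 x = Pi n x * (1 - x ^+ n.+1).
Proof. by rewrite /Pi big_nat_recr. Qed.

Lemma bin2_even k : 'C((2 * k).+1, 2) = (k * (2 * k).+1)%N.
Proof. by rewrite bin2 /= mulSn -[X in (X + _)./2]addn0; lia. Qed.

Lemma bin2_odd k : 'C((2 * k).+2, 2) = (k * (2 * k).+1 + (2 * k).+1)%N.
Proof. by rewrite binS bin1 bin2_even. Qed.

Lemma sum_pairs (V : zmodType) (g : nat -> V) m :
  \sum_(c < (2 * m.+1)%N) g c = \sum_(k < m.+1) (g (2 * k)%N + g (2 * k).+1).
Proof.
elim: m => [|m IH]; first by rewrite !big_ord_recr !big_ord0 /= !add0r.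
by rewrite [RHS]big_ord_recr /= -IH mulnS !addSn add0n !big_ord_recr /= addrA.
Qed.

(** * Polynomials as power series modulo [X^N] *)

Section TruncatedSeries.
Variable N : nat.

Definition eqmodXn (P R : {poly rat}) := forall e, (e < N)%N -> P`_e = R`_e.

Lemma eqmodXn_sym P R : eqmodXn P R -> eqmodXn R P.
Proof. by move=> h e le; rewrite h. Qed.

Lemma eqmodXn_trans P R S : eqmodXn P R -> eqmodXn R S -> eqmodXn P S.
Proof. by move=> h h' e le; rewrite h // h'. Qed.

Lemma eqmodXn_mul (A P R : {poly rat}) : eqmodXn P R -> eqmodXn (A * P) (A * R).
Proof.
move=> h e le; rewrite !coefM; apply: eq_bigr => i _; rewrite h //.
exact: leq_ltn_trans (leq_subr _ _) le.
Qed.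

Lemma eqmodXn_scale a (P R : {poly rat}) : eqmodXn P R -> eqmodXn (a *: P) (a *: R).
Proof. by move=> h e le; rewrite !coefZ h. Qed.

Lemma eqmodXn_add (P R P' R' : {poly rat}) : eqmodXn P R -> eqmodXn P' R' -> eqmodXn (P + P') (R + R').
Proof. by move=> h h' e le; rewrite !coefD h // h'. Qed.

Lemma eqmodXn_sum n (F G : nat -> {poly rat}) :
  (forall c, (c < n)%N -> eqmodXn (F c) (G c)) ->
  eqmodXn (\sum_(c < n) F c) (\sum_(c < n) G c).
Proof.
by move=> h e le; rewrite !coef_sum; apply: eq_bigr => i _; apply: h.
Qed.

(** A series with nonzero constant term is invertible; concretely, the coefficients agree by strong
    induction on the degree. *)
Lemma eqmodXn_cancel (A P R : {poly rat}) : A`_0 != 0 -> eqmodXn (A * P) (A * R) -> eqmodXn P R.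
Proof.
move=> A0 h; elim/ltn_ind => e IH le.
have := h e le; rewrite !coefM !big_ord_recl /= !subn0.
rewrite [X in _ + X = _](eq_bigr (fun i : 'I_e => A`_(bump 0 i) * R`_(e - bump 0 i))).
  by move/addIr/(mulfI A0).
move=> i _; have le_i := ltn_ord i.
have be : (e - bump 0 i < e)%N by rewrite /bump add1n; lia.
by rewrite IH // (ltn_trans be).
Qed.

Definition series (u : nat -> rat) : {poly rat} := \poly_(e < N) u e.

Lemma series_mul1B a u e : (e < N)%N ->
  ((1 - a *: 'X) * series u)`_e = u e - (if e is e'.+1 then a * u e' else 0).
Proof.
move=> le; rewrite mulrBl mul1r -scalerAl coefB coefZ coefXM !coef_poly le.
by case: e le => [|e] le /=; rewrite ?mulr0 // ltnW.
Qed.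

End TruncatedSeries.

(** * The corank distribution and its recursion *)

Section QIdentities.
Variable q : rat.
Hypotheses (q_gt0 : 0 < q) (q_lt1 : q < 1).

Let Q := q ^+ 2.

Lemma one_sub_pow_neq0 n : 1 - q ^+ n.+1 != 0.
Proof. by rewrite subr_eq0 eq_sym lt_eqF // exprn_ilt1 // ltW. Qed.

Lemma one_sub_pow2_neq0 n : 1 - Q ^+ n.+1 != 0.
Proof. by rewrite -exprM mulnS; apply: one_sub_pow_neq0. Qed.

Lemma Pi_neq0 n : Pi n q != 0.
Proof.
by elim: n => [|n IH]; rewrite ?Pi0 ?oner_eq0 // PiS mulf_neq0 // one_sub_pow_neq0.
Qed.

Lemma Pi2_neq0 n : Pi n Q != 0.
Proof.
by elim: n => [|n IH]; rewrite ?Pi0 ?oner_eq0 // PiS mulf_neq0 // one_sub_pow2_neq0.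
Qed.

(* Probability that a random symmetric [n x n] matrix over a field with [1/q]
   elements has corank [c]. *)
Definition corank_law n c : rat :=
  if (c <= n)%N then q ^+ 'C(c.+1, 2) * Pi n q / (Pi c q * Pi (n - c)./2 Q) else 0.

(** The same three outcomes as in [avgS]; the third one raises the corank by one. *)
Lemma corank_lawS n c :
  corank_law n.+1 c = (1 - q) * corank_law n c + q * (1 - q ^+ n) * corank_law n.-1 c
    + q ^+ n.+1 * (if c is c'.+1 then corank_law n c' else 0).
Proof.
have [lcn|] := leqP c n; last first.
  rewrite ltnNge => /negP h; rewrite /corank_law; have [lcn|//] := boolP (c <= n.+1)%N; last first.
    case: c h => // c h nn; rewrite !ifN ?mulr0 ?addr0 //; lia.
  have -> : c = n.+1 by lia.
  rewrite !leqnn ltnn !subnn Pi0 (_ : (n.+1 <= n.-1)%N = false); last by lia.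
  rewrite binS bin1 exprD PiS; have P0 := Pi_neq0 n; have u := one_sub_pow_neq0 n.
  by field; rewrite P0 u.
(* Brings the last term to the common denominator; the factor [1 - q ^+ c] accounts for [c = 0]. *)
have -> : q ^+ n.+1 * (if c is c'.+1 then corank_law n c' else 0) =
   q ^+ (n.+1 - c) * (1 - q ^+ c) * q ^+ 'C(c.+1, 2) * Pi n q
     / (Pi c q * Pi (n.+1 - c)./2 Q).
  case: c lcn => [|c] lcn; first by rewrite expr0 subrr !mulr0 !mul0r.
  rewrite /corank_law ltnW // (binS c.+1) bin1 exprD PiS subSS.
  have -> : q ^+ n.+1 = q ^+ (n - c) * q ^+ c.+1 by rewrite -exprD; congr (_ ^+ _); lia.
  have P0 := Pi_neq0 c; have P1 := Pi2_neq0 (n - c)./2; have u := one_sub_pow_neq0 c.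
  by field; rewrite P0 P1 u.
rewrite /corank_law lcn leqW // PiS.
have [k ->] : exists k, n = (c + k)%N by exists (n - c)%N; lia.
have -> : ((c + k).+1 - c = k.+1)%N by lia.
have -> : (c + k - c = k)%N by lia.
have [j [->|->]] : exists j, k = j.*2 \/ k = j.*2.+1.
- by exists k./2; case: (boolP (odd k)) => h; [right|left]; lia.
- rewrite doubleK (_ : (j.*2.+1)./2 = j); last by lia.
  rewrite -(mulrA q (1 - _)); have -> : (1 - q ^+ (c + j.*2)) *
     (if (c <= (c + j.*2).-1)%N
      then q ^+ 'C(c.+1, 2) * Pi (c + j.*2).-1 q / (Pi c q * Pi ((c + j.*2).-1 - c)./2 Q) else 0)
   = (1 - Q ^+ j) * (q ^+ 'C(c.+1, 2) * Pi (c + j.*2) q / (Pi c q * Pi j Q)).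
    (* For [j = 0] both sides vanish: either the corank exceeds the size, or [c = 0] and the factor
       [1 - q ^+ 0] is zero. *)
    case: j => [|j].
      case: c lcn => [|c] _; rewrite ?addn0 ?expr0 ?subrr ?mul0r //=.
      by rewrite ltnn mulr0.
    rewrite ifT; last lia.
    have -> : (c + j.+1.*2 = (c + j.*2.+1).+1)%N by lia.
    rewrite /= addKn (_ : j.*2.+1./2 = j) ?PiS; last by lia.
    have P0 := Pi_neq0 c; have P1 := Pi2_neq0 j; have u := one_sub_pow2_neq0 j.
    by field; rewrite P0 P1 u.
  have -> : q ^+ (c + j.*2).+1 = q ^+ j.*2.+1 * q ^+ c by rewrite -exprD; congr (_ ^+ _); lia.
  have -> : Q ^+ j = q ^+ j.*2 by rewrite /Q -exprM mul2n.
  have P0 := Pi_neq0 c; have P1 := Pi2_neq0 j; rewrite exprS.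
  by field; rewrite P0 P1.
- have -> : (j.*2.+1)./2 = j by lia.
  have -> : (j.*2.+2)./2 = j.+1 by lia.
  rewrite addnS /= leq_addr addKn doubleK !PiS.
  have -> : q ^+ (c + j.*2).+2 = q ^+ j.*2.+2 * q ^+ c by rewrite -exprD; congr (_ ^+ _); lia.
  have -> : q ^+ (j.*2.+2) = Q ^+ j.+1 by rewrite /Q -exprM; congr (_ ^+ _); lia.
  have P0 := Pi_neq0 c; have P1 := Pi2_neq0 j; have u := one_sub_pow2_neq0 j.
  by field; rewrite P0 P1 u.
Qed.

Lemma corank_law0 : corank_law 0 0 = 1.
Proof. by rewrite /corank_law /= !Pi0 expr0 !mul1r. Qed.

Lemma corank_law_gt n c : (n < c)%N -> corank_law n c = 0.
Proof. by rewrite /corank_law ltnNge => /negPf->. Qed.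

(** [A m n] stands for [avg m n f]. The number [d] of dead rows varies in the induction, since the
    third outcome increases it. *)
Lemma corank_expansion (A : nat -> nat -> rat) :
  (forall m n, (n <= m)%N -> A m.+1 n.+1 =
     (1 - q) * A m n + q * (1 - q ^+ n) * A m.-1 n.-1 + q ^+ n.+1 * A m.+1 n) ->
  forall n d, A (d + n)%N n = \sum_(c < n.+1) corank_law n c * A (d + c)%N 0%N.
Proof.
move=> hA n; elim/ltn_ind: n => -[|n] IH d.
  by rewrite big_ord1 corank_law0 mul1r.
rewrite addnS hA ?leq_addl //.
under eq_bigr => c _ do rewrite corank_lawS mulrDl mulrDl.
rewrite !big_split /=; congr (_ + _ + _).
- rewrite big_ord_recr /= corank_law_gt // mulr0 mul0r addr0 IH // mulr_sumr.
  by apply: eq_bigr => c _; rewrite mulrA.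
- case: n IH => [|n] IH /=.
    by rewrite expr0 subrr mulr0 mul0r big1 // => c _; rewrite !mul0r.
  rewrite addnS /= IH; last by lia.
  rewrite [RHS]big_ord_recr [X in _ = X + _]big_ord_recr /=.
  rewrite (corank_law_gt (leqnn _)) corank_law_gt // !mulr0 !mul0r !addr0 mulr_sumr.
  by apply: eq_bigr => c _; rewrite mulrA.
- rewrite -addSn IH // mulr_sumr [RHS]big_ord_recl /= mulr0 mul0r add0r.
  by apply: eq_bigr => c _; rewrite /bump /= add1n addSnnS mulrA.
Qed.

(** * Gaussian binomials and the Durfee square identity *)

Definition gauss_binom (Q : rat) m k : rat :=
  if (k <= m)%N then Pi m Q / (Pi k Q * Pi (m - k) Q) else 0.

Lemma gauss_binom_gt Q' m k : (m < k)%N -> gauss_binom Q' m k = 0.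
Proof. by rewrite /gauss_binom ltnNge => /negPf->. Qed.

Lemma gauss_binomS m k : gauss_binom Q m.+1 k =
  gauss_binom Q m k + (if k is k'.+1 then Q ^+ (m - k') * gauss_binom Q m k' else 0).
Proof.
have P0 := Pi2_neq0.
case: k => [|k]; first by rewrite /gauss_binom !subn0 Pi0 addr0 !mul1r !divff.
rewrite /gauss_binom ltnS subSS; have [lkm|gkm] := leqP k m; last first.
  by rewrite ltnNge (ltnW gkm) mulr0 addr0.
have [j ->] : exists j, m = (k + j)%N by exists (m - k)%N; lia.
rewrite addKn !PiS; case: j => [|j].
  rewrite addn0 ltnn expr0 Pi0 add0r mul1r.
  by field; rewrite P0 one_sub_pow2_neq0.
have -> : (k < k + j.+1)%N by lia.
have -> : (k + j.+1 - k.+1 = j)%N by lia.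
have -> : Q ^+ (k + j.+1).+1 = Q ^+ k.+1 * Q ^+ j.+1 by rewrite -exprD; congr (_ ^+ _); lia.
rewrite PiS.
by field; rewrite !P0 !one_sub_pow2_neq0.
Qed.

(* Finite form of the Durfee square identity. *)
Lemma durfee m (z : {poly rat}) :
  \sum_(k < m.+1) gauss_binom Q m k *: (Q ^+ (k ^ 2) *: z ^+ k
     * \prod_(k <= i < m) (1 - Q ^+ i.+1 *: z)) = 1.
Proof.
elim: m z => [|m IH] z.
  by rewrite big_ord1 big_geq // /gauss_binom /= !Pi0 exp0n // !expr0 !scale1r ?mulr1 ?scale1r.
under eq_bigr => k _ do rewrite gauss_binomS scalerDl.
rewrite big_split big_ord_recr /= gauss_binom_gt // scale0r addr0.
(* The unshifted terms of the Pascal rule are those for [m], times the new last factor of the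
   product. *)
have -> : \sum_(k < m.+1) gauss_binom Q m k *: (Q ^+ (k ^ 2) *: z ^+ k *
    \prod_(k <= i < m.+1) (1 - Q ^+ i.+1 *: z)) = 1 - Q ^+ m.+1 *: z.
  rewrite -[RHS]mul1r -[X in _ = X * _](IH z) mulr_suml; apply: eq_bigr => k _.
  have lkm : (k <= m)%N by rewrite -ltnS.
  by rewrite big_nat_recr //= mulrA scalerAl.
rewrite big_ord_recl /= scale0r add0r.
suff -> : \sum_(i < m.+1) (Q ^+ (m - i) * gauss_binom Q m i) *: (Q ^+ (bump 0 i ^ 2) *: z ^+ bump 0 i *
    \prod_(bump 0 i <= i0 < m.+1) (1 - Q ^+ i0.+1 *: z)) = Q ^+ m.+1 *: z.
  by rewrite subrK.
(* The shifted terms form the identity at [Q z], times [Q ^ (m + 1) z]. *)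
rewrite -[RHS]mulr1 -[X in _ = _ * X](IH (Q *: z)) mulr_sumr.
apply: eq_bigr => k _; rewrite /bump add1n big_add1 /=.
under eq_bigr => i _ do rewrite exprSr -scalerA.
set p := \prod_(_ <= _ < _) _; rewrite exprZn (exprS z) -?scalerAl -?scalerAr -?scalerAl -?scalerAr !scalerA mulrA.
have lkm : (k <= m)%N by rewrite -ltnS.
congr (_ *: _); last by rewrite mulrA.
rewrite mulrAC.
have -> : Q ^+ (m - k) * Q ^+ (k.+1 ^ 2) = Q ^+ m.+1 * Q ^+ (k ^ 2) * Q ^+ k.
  by rewrite -!exprD -!mulnn; congr (_ ^+ _); lia.
by ring.
Qed.

(** * Numerators and denominators of the generating functions *)

Definition quad_den k m : {poly rat} := \prod_(k <= i < m) (1 - q ^+ (2 * i).+3 *: 'X^2).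

Definition numer n : {poly rat} :=
  (Pi n q / Pi n./2 Q) *: (if odd n then 1 else 1 - q ^+ n.+1 *: 'X).

(** This is [durfee] at [z = q X^2]: the power becomes [q ^ (2 k^2 + k)] and the factors become
    those of [quad_den]. *)
Lemma durfee_quad_den m :
  \sum_(k < m.+1) gauss_binom Q m k *: (q ^+ (k * (2 * k).+1) *: ('X^(2 * k) * quad_den k m)) = 1.
Proof.
rewrite -[RHS](durfee m (q *: 'X^2)); apply: eq_bigr => k _.
rewrite exprZn -!scalerAl [X in _ = _ *: X]scalerA -!exprM -exprD; congr (_ *: (_ *: (_ * _))).
  by congr (_ ^+ _); rewrite -mulnn; lia.
apply: eq_bigr => i _; rewrite scalerA -exprM -exprSr.
by congr (1 - _ ^+ _ *: _); lia.
Qed.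

(** Up to a common factor the two terms are [1 - q ^ (2k + 1) X] and [q ^ (2k + 1) X], the latter
    times [1 - Q ^ (m - k)] if [n] is even. Their sum is 1 or [1 - q ^ (n + 1) X], free of [k]. *)
Lemma corank_law_pair n k : (2 * k <= n)%N ->
  let m := n./2 in
  corank_law n (2 * k) *: ('X^(2 * k) * quad_den k m * numer (2 * k))
    + corank_law n (2 * k).+1 *: ('X^((2 * k).+1) * quad_den k m * numer (2 * k).+1)
  = gauss_binom Q m k *: (q ^+ (k * (2 * k).+1) *: ('X^(2 * k) * quad_den k m)) * numer n.
Proof.
move=> l2kn m; rewrite /numer /=.
have -> : (2 * k)./2 = k by lia.
have -> : uphalf (2 * k) = k by lia.
have -> : odd (2 * k) = false by rewrite oddM.
have lkm : (k <= m)%N by rewrite /m; lia.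
set B := 'X^(2 * k) * quad_den k m.
have -> : corank_law n (2 * k) *: (B * ((Pi (2 * k) q / Pi k Q) *: (1 - q ^+ (2 * k).+1 *: 'X)))
  = (Pi n q / Pi m Q) *: (gauss_binom Q m k *: (q ^+ (k * (2 * k).+1) *: (B * (1 - q ^+ (2 * k).+1 *: 'X)))).
  rewrite -scalerAr !scalerA; congr (_ *: _).
  rewrite /corank_law l2kn /gauss_binom lkm bin2_even (_ : (n - 2 * k)./2 = m - k)%N; last by rewrite /m; lia.
  have P0 := Pi_neq0; have P2 := Pi2_neq0.
  by field; rewrite P0 !P2.
have -> : 'X^((2 * k).+1) * quad_den k m = 'X * B by rewrite exprS -mulrA.
have -> : corank_law n (2 * k).+1 *: (('X * B) * ((Pi (2 * k).+1 q / Pi k Q) *: 1))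
  = (Pi n q / Pi m Q) *: (gauss_binom Q m k *: (q ^+ (k * (2 * k).+1) *:
       (B * ((if odd n then q ^+ (2 * k).+1 else q ^+ (2 * k).+1 * (1 - Q ^+ (m - k))) *: 'X)))).
  rewrite -!scalerAr mulr1 (mulrC 'X) !scalerA; congr (_ *: _).
  have P0 := Pi_neq0; have P2 := Pi2_neq0.
  have [l2kn1|] := leqP (2 * k).+1 n.
    rewrite /corank_law l2kn1 /gauss_binom lkm bin2_odd exprD.
    case: (boolP (odd n)) => on.
      rewrite (_ : (n - (2 * k).+1)./2 = m - k)%N; last by rewrite /m; lia.
      by field; rewrite !P0 !P2.
    have [j jE] : exists j, (m - k)%N = j.+1 by exists (m - k).-1; rewrite /m; lia.
    rewrite (_ : (n - (2 * k).+1)./2 = j)%N ?jE ?PiS; last by move: jE; rewrite /m; lia.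
    by field; rewrite !P0 !P2 one_sub_pow2_neq0 one_sub_pow_neq0.
  move=> h; have nE : n = (2 * k)%N by lia.
  rewrite corank_law_gt // nE oddM /= (_ : (m - k)%N = 0%N); last by rewrite /m nE; lia.
  by rewrite expr0 subrr !mulr0 mul0r.
rewrite -!scalerDr -mulrDr [RHS]mulrC -!scalerAl -!scalerAr; congr (_ *: _).
congr (_ *: (_ *: _)); rewrite mulrC; congr (_ * _).
rewrite -addrA -[RHS]addr0 -scaleNr -scalerDl.
case: (boolP (odd n)) => on.
  by rewrite addNr scale0r addr0.
rewrite addr0 -scaleNr; congr (_ + _ *: _).
rewrite mulrBr mulr1 addrA addNr add0r /Q -exprM -exprD; congr (- (_ ^+ _)).
by rewrite /m; lia.
Qed.

Lemma numer_identity n :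
  \sum_(c < n.+1) corank_law n c *: ('X^c * quad_den c./2 n./2 * numer c) = numer n.
Proof.
pose g c := corank_law n c *: ('X^c * quad_den c./2 n./2 * numer c).
(* For even [n] the range is padded with corank [n.+1], whose term is zero. *)
have -> : \sum_(c < n.+1) g c = \sum_(c < (2 * n./2.+1)%N) g c.
  case: (boolP (odd n)) => on; first by rewrite (_ : (2 * n./2.+1)%N = n.+1) //; lia.
  have -> : (2 * n./2.+1 = n.+2)%N by lia.
  by rewrite [RHS]big_ord_recr /= /g corank_law_gt // scale0r addr0.
rewrite sum_pairs -[RHS]mul1r -[X in _ = X * _](durfee_quad_den n./2) mulr_suml.
apply: eq_bigr => k _; rewrite -corank_law_pair; last by case: k => k /= h; lia.
by rewrite /g (_ : (2 * k)./2 = k) 1?(_ : (2 * k).+1./2 = k) //; lia.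
Qed.

(** * Generating functions of the probabilities *)

Section Truncation.
Variable N : nat.

Lemma quad_den_split k m : (k <= m)%N -> quad_den 0 m = quad_den 0 k * quad_den k m.
Proof. by move=> lkm; rewrite /quad_den (big_cat_nat (n := k)). Qed.

Lemma quad_den_coef0 k m : (quad_den k m)`_0 = 1.
Proof.
rewrite /quad_den -horner_coef0 horner_prod big1 // => i _.
by rewrite horner_coef0 coefB coef1 coefZ coefXn mulr0 subr0.
Qed.

Definition lin_den : {poly rat} := (1 - 'X) * (1 - q *: 'X).

Lemma den_coef0 m : (lin_den * quad_den 0 m)`_0 = 1.
Proof.
rewrite -horner_coef0 /lin_den !hornerM !horner_coef0 quad_den_coef0.
by rewrite !coefB coef1 coefZ coefX mulr0 !subr0 !mulr1.
Qed.

(** By [numer_identity] the numerators solve the same recursion. At [n = 0] that recursion is a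
    tautology, so [G 0] is given separately. *)
Lemma truncated_series_numer (G : nat -> {poly rat}) :
  eqmodXn N ((1 - 'X) * G 0%N) 1 ->
  (forall n, eqmodXn N (G n) (\sum_(c < n.+1) corank_law n c *: ('X^c * G c))) ->
  forall n, eqmodXn N (lin_den * quad_den 0 n./2 * G n) (numer n).
Proof.
move=> G0 hG n; elim/ltn_ind: n => -[|n] IH.
  rewrite /lin_den /numer /quad_den big_geq //= mulr1 expr1 (mulrC (1 - 'X)) -mulrA.
  rewrite !Pi0 divr1 scale1r -[X in eqmodXn N _ X]mulr1.
  exact: eqmodXn_mul.
set m := n.+1./2; set L := lin_den * quad_den 0 m.
(* The term [c = n.+1] contains [G n.+1] itself; it moves to the left, where the factor has constant
   term 1. *)
apply: (@eqmodXn_cancel N (1 - corank_law n.+1 n.+1 *: 'X^(n.+1))).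
  by rewrite coefB coef1 coefZ coefXn mulr0 subr0 oner_neq0.
have hs : eqmodXn N (L * G n.+1) (\sum_(c < n.+1) corank_law n.+1 c *: ('X^c * quad_den c./2 m * numer c)
   + corank_law n.+1 n.+1 *: 'X^(n.+1) * (L * G n.+1)).
  apply: eqmodXn_trans (eqmodXn_mul _ (hG n.+1)) _.
  rewrite big_ord_recr /= mulrDr; apply: eqmodXn_add; last first.
    by rewrite -scalerAr -scalerAl mulrCA.
  rewrite mulr_sumr; apply: (eqmodXn_sum (F := fun c => L * (corank_law n.+1 c *: ('X^c * G c)))
     (G := fun c => corank_law n.+1 c *: ('X^c * quad_den c./2 m * numer c))) => c lc.
  have lcm : (c./2 <= m)%N by rewrite /m; lia.
  rewrite -scalerAr; apply: eqmodXn_scale.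
  have -> : L * ('X^c * G c) = 'X^c * quad_den c./2 m * (lin_den * quad_den 0 c./2 * G c).
    by rewrite /L (quad_den_split lcm); ring.
  exact/eqmodXn_mul/IH.
have E : \sum_(c < n.+1) corank_law n.+1 c *: ('X^c * quad_den c./2 m * numer c)
   = numer n.+1 - corank_law n.+1 n.+1 *: 'X^(n.+1) * numer n.+1.
  rewrite -[X in _ = X - _]numer_identity [in RHS]big_ord_recr /= -/m.
  by rewrite [quad_den m m]big_geq // mulr1 scalerAl addrK.
by rewrite !mulrBl !mul1r -E => e le; rewrite coefB hs // coefD addrK.
Qed.

(** * Generating functions of [T] and of the closed formula *)

Lemma T0 beta k : T beta k 0 q = 1.
Proof.
rewrite /T; case: eqP => // _.
by rewrite big_nat1 muln0 expr0 mul1r addn0 Pi0 mul1r divff // Pi2_neq0.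
Qed.

(** For generating functions in a variable [Y] marking [s], raising [k] by one divides by
    [1 - q ^ (beta + 2k) Y]. *)
Lemma T_succ beta k s :
  T beta k.+1 s q = T beta k s q
    + (if s is s'.+1 then q ^+ (beta + 2 * k) * T beta k.+1 s' q else 0).
Proof.
have P2 := Pi2_neq0.
elim: s => [|s IH].
  by rewrite addr0 !T0.
have TS k' s' : T beta k'.+1 s'.+1 q = T beta k'.+1 s' q + q ^+ (beta * s'.+1) *
    (Pi (k' + s'.+1) Q / (Pi s'.+1 Q * Pi k' Q)).
  rewrite /T /= big_nat_recr //= addSn !subn1 /=; congr (_ + _).
  by rewrite -mulrA; congr (_ * (Pi _ _ / _)).
have R0 : (if s is s'.+1 then q ^+ (beta + 2 * k) * T beta k.+1 s' q else 0)
   + q ^+ (beta + 2 * k) * (q ^+ (beta * s) * (Pi (k + s) Q / (Pi s Q * Pi k Q)))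
   = q ^+ (beta + 2 * k) * T beta k.+1 s q.
  case: s {IH} => [|s]; last by rewrite TS mulrDr.
  by rewrite add0r T0 muln0 expr0 addn0 Pi0 !mul1r divff.
rewrite TS -R0 {}IH; case: k {R0} => [|k].
  rewrite {1 3}/T /= !add0n Pi0 muln0 addn0 !mulr1 !divff // !mulr1 mulnS exprD.
  by rewrite addrA addrAC -!addrA.
rewrite (TS k) (mulnS beta).
have -> : (k.+1 + s.+1 = (k + s.+1).+1)%N by [].
have -> : (k.+1 + s = k + s.+1)%N by rewrite addnS.
have -> : q ^+ (beta + 2 * k.+1) = q ^+ beta * Q ^+ k.+1 by rewrite /Q -exprM -exprD.
rewrite !PiS exprD (_ : (k + s.+1).+1 = k.+1 + s.+1)%N // (exprD Q).
set X := (if s is _.+1 then _ else _).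
by field; rewrite !P2 !one_sub_pow2_neq0.
Qed.

(** A step of 2 in [e] is a step of 1 in [s], and the condition on [a] turns the factor
    [a ^ 2 q ^ (beta + 2k)] into the [q ^ (2k + 3)] of [quad_den]. It is applied with [beta = 3],
    [a = 1] and with [beta = 1], [a = q]. *)
Lemma T_series beta a k : a ^+ 2 * q ^+ beta = q ^+ 3 ->
  eqmodXn N ((1 - a *: 'X) * quad_den 0 k * series N (fun e => a ^+ e * T beta k e./2 q)) 1.
Proof.
move=> ha; elim: k => [|k IH].
  rewrite /quad_den big_geq // mulr1 => e le; rewrite series_mul1B //.
  by case: e le => [|e] le; rewrite coef1 /T /= !mulr1 ?subr0 ?expr0 // exprS subrr.
apply: eqmodXn_trans IH; rewrite (@quad_den_split k k.+1) // -!mulrA.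
apply/eqmodXn_mul/eqmodXn_mul; rewrite /quad_den big_nat1 => e le.
rewrite mulrBl mul1r -scalerAl coefB coefZ coefXnM !coef_poly le T_succ mulrDr.
case: e le => [|[|e]] le /=; rewrite ?mulr0 ?subr0 ?addr0 //.
rewrite !subSS subn0 ltnW ?(ltnW (leqW _)) //; last exact: ltnW.
rewrite -addrA -[RHS]addr0; congr (_ + _); apply/eqP; rewrite subr_eq0; apply/eqP.
rewrite !mulrA; congr (_ * _).
have -> : q ^+ (2 * k).+3 = q ^+ 3 * q ^+ (2 * k) by rewrite -exprD.
rewrite -ha exprD -addn2 exprD; ring.
Qed.

Definition formula n mu : rat :=
    Pi (2 * n./2) q / ((1 - q) * Pi n./2 Q) *
    ((1 - q ^+ (2 * n./2).+1) * T 3 n./2 (mu.-1)./2 q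
     - q ^+ mu * (1 - q ^+ n) * T 1 n./2 (mu.-1)./2 q).

Lemma formula_series n :
  eqmodXn N (lin_den * quad_den 0 n./2 * series N (fun e => formula n e.+1)) (numer n).
Proof.
set k := n./2.
have -> : series N (fun e => formula n e.+1) = (Pi (2 * k) q / ((1 - q) * Pi k Q)) *:
   ((1 - q ^+ (2 * k).+1) *: series N (fun e => 1 ^+ e * T 3 k e./2 q)
     - (q * (1 - q ^+ n)) *: series N (fun e => q ^+ e * T 1 k e./2 q)).
  apply/polyP=> e; rewrite !(coefZ, coefB, coef_poly) /formula -/k /=.
  by case: ltnP => _; rewrite ?expr1n ?exprS; ring.
set A3 := series N _; set A1 := series N _.
have h3 : eqmodXn N ((1 - 1 *: 'X) * quad_den 0 k * A3) 1 by apply: T_series; rewrite expr1n mul1r.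
have h1 : eqmodXn N ((1 - q *: 'X) * quad_den 0 k * A1) 1 by apply: T_series; rewrite -exprD.
rewrite scale1r in h3.
set C := _ / _; set a := 1 - _ ^+ _; set b := q * _.
have -> : lin_den * quad_den 0 k * (C *: (a *: A3 - b *: A1)) =
   C *: (a *: ((1 - q *: 'X) * ((1 - 'X) * quad_den 0 k * A3))
       + (- b) *: ((1 - 'X) * ((1 - q *: 'X) * quad_den 0 k * A1))).
  by rewrite /lin_den -!mul_polyC; rewrite raddfN /=; ring.
have -> : numer n = C *: (a *: ((1 - q *: 'X) * 1) + (- b) *: ((1 - 'X) * 1)).
  have -> : C *: (a *: ((1 - q *: 'X) * 1) + (- b) *: ((1 - 'X) * 1))
     = (C * (a - b)) *: 1 + (C * (b - a * q)) *: 'X.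
    by rewrite -!mul_polyC; ring.
  have q1 := one_sub_pow_neq0 0; rewrite expr1 in q1; have P2 := Pi2_neq0 k.
  (* For odd [n] the coefficient of [X] cancels; for even [n] both coefficients contain [1 - q],
     which cancels the one in [C]. *)
  rewrite /numer -/k; case: (boolP (odd n)) => on.
    have nE : n = (2 * k).+1 by rewrite /k; lia.
    have -> : C * (b - a * q) = 0 by rewrite /b /a nE; ring.
    rewrite scale0r addr0; congr (_ *: _).
    by rewrite /C /b /a nE PiS; field; rewrite q1 P2.
  have nE : n = (2 * k)%N by rewrite /k; lia.
  rewrite scalerBr scalerA -scaleNr; congr (_ *: _ + _ *: _).
    by rewrite /C /b /a -nE exprS; field; rewrite q1 P2.
  by rewrite /C /b /a -nE exprS; field; rewrite q1 P2.
by apply/eqmodXn_scale/eqmodXn_add; apply/eqmodXn_scale/eqmodXn_mul.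
Qed.

End Truncation.
End QIdentities.

(** * Special averages and the link with [symP] *)

Section AvgLemmas.
Variable R : finComUnitRingType.

Lemma tail_mass_full m (F : R -> rat) :
  tail_mass m m F = \sum_(A : 'M[R]_m | A^T == A) F (\det A).
Proof.
apply: eq_bigl => A; apply/symDP/eqP => [[]//|sA]; split=> // i j.
by rewrite /dead_tail leqNgt ltn_ord.
Qed.

Lemma eq_avg m n (f g : R -> rat) : f =1 g -> avg m n f = avg m n g.
Proof. by move=> e; congr (_ / _); apply: eq_bigr => A _; rewrite e. Qed.

Lemma avg0 m n : avg m n (fun _ : R => 0) = 0.
Proof. by rewrite /avg {1}/tail_mass {1}/mass big1 // mul0r. Qed.

Lemma avg00 (f : R -> rat) : avg 0 0 f = f 1.
Proof.
rewrite /avg !tail_mass_full (eq_bigr (fun=> f 1)) => [|A _]; last by rewrite det_mx00.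
rewrite sum_cst -mulrA mulrCA divff ?mulr1 //.
by rewrite (bigD1 0) /= ?trmx0 // lt0r_neq0 // ltr_pwDl // sumr_ge0.
Qed.

End AvgLemmas.

Lemma symP_avg m n (pi : 'Z_m) :
  symP m n = avg n n (fun x : 'Z_m => (pi ^+ 0 * x != 0)%:R).
Proof.
rewrite /avg !tail_mass_full /symP; congr (_ / _).
  rewrite -sum1_card natr_sum big_mkcond /= [RHS]big_mkcond /=; apply: eq_bigr => A _.
  by rewrite inE expr0 mul1r; case: eqP => //= _; case: eqP.
rewrite -sum1_card natr_sum; apply: eq_bigl => A.
by rewrite inE.
Qed.

(** * The ring of integers modulo [p ^ mu] *)

Section PrimePower.
Variables (p mu : nat).
Hypotheses (p_pr : prime p) (mu_gt0 : (0 < mu)%N).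

Let pmu_gt1 : (1 < p ^ mu)%N.
Proof. by rewrite -(exp1n mu) ltn_exp2r // prime_gt1. Qed.

Lemma Zp_unitE (x : 'Z_(p ^ mu)) : (x \is a GRing.unit) = ~~ (p %| x)%N.
Proof.
rewrite -{1}(natr_Zp x) unitZpE // coprime_pexpl //.
by rewrite prime_coprime.
Qed.

Lemma Zp_nonunitP (x : 'Z_(p ^ mu)) : nonunit x <-> exists y, x = p%:R * y.
Proof.
rewrite /nonunit Zp_unitE negbK; split=> [/dvdnP[k e]|[y ->]].
  by exists k%:R; rewrite -natrM mulnC -e natr_Zp.
suff : ~~ (p%:R * y \is a GRing.unit) by rewrite Zp_unitE negbK.
by rewrite unitrM unitZpE // coprime_pexpl // prime_coprime // dvdnn.
Qed.

Lemma Zp_pi_pow e : (p%:R ^+ e == 0 :> 'Z_(p ^ mu)) = (mu <= e)%N.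
Proof.
rewrite -natrX -(dvdn_Pexp2l _ _ (prime_gt1 p_pr)).
by rewrite -val_eqE /= val_Zp_nat.
Qed.

(** The units are counted by Euler's totient of [p ^ mu]. *)
Lemma Zp_nonunit_ratio : nonunit_ratio 'Z_(p ^ mu) = p%:R^-1.
Proof.
have hr : ring_count 'Z_(p ^ mu) = (p ^ mu)%:R.
  by rewrite /ring_count sumr_const card_ord Zp_cast.
have hu : ring_count 'Z_(p ^ mu) - nonunit_count 'Z_(p ^ mu) = (totient (p ^ mu))%:R.
  rewrite /ring_count (bigID (@nonunit _)) /= addrC addrK.
  have -> : totient (p ^ mu) = (\sum_(d < (Zp_trunc (p ^ mu)).+2) coprime (p ^ mu) d)%N.
    rewrite -(big_mkord xpredT (fun d => nat_of_bool (coprime (p ^ mu) d))).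
    by rewrite Zp_cast // totient_count_coprime.
  rewrite natr_sum big_mkcond /=.
  apply: eq_bigr => i _; rewrite /nonunit negbK Zp_unitE.
  by rewrite coprime_pexpl // prime_coprime //; case: (_ %| _)%N.
rewrite /nonunit_ratio; move: hu; rewrite hr totient_pfactor // => hu.
have p0 : (p%:R : rat) != 0 by rewrite pnatr_eq0 -lt0n prime_gt0.
have -> : nonunit_count 'Z_(p ^ mu) = (p ^ mu)%:R - (p.-1 * p ^ mu.-1)%:R.
  by rewrite -hu opprB addrCA subrr addr0.
have pE : p%:R = p.-1%:R + 1 :> rat by rewrite natr1 prednK ?prime_gt0.
rewrite -[in (p ^ mu)%N](prednK mu_gt0) expnS !natrM natrX.
have pk0 : (p%:R : rat) ^+ mu.-1 != 0 by rewrite expf_neq0.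
by rewrite pE in p0 pk0 *; field; rewrite p0 pk0.
Qed.

End PrimePower.

Theorem theorem5p1 (p mu n : nat) :
  prime p -> (1 <= n)%N -> (1 <= mu)%N ->
  symP (p ^ mu) n =
    Pi (2 * n./2) (p%:R^-1) / ((1 - p%:R^-1) * Pi n./2 (p%:R^-1 ^+ 2)) *
    ((1 - (p%:R^-1) ^+ (2 * n./2).+1) * T 3 n./2 (mu.-1)./2 (p%:R^-1)
     - (p%:R^-1) ^+ mu * (1 - (p%:R^-1) ^+ n) * T 1 n./2 (mu.-1)./2 (p%:R^-1)).
Proof.
move=> p_pr _ mu_gt0; pose q : rat := p%:R^-1; pose R : finComUnitRingType := 'Z_(p ^ mu).
have q_gt0 : 0 < q by rewrite invr_gt0 ltr0n prime_gt0.
have q_lt1 : q < 1 by rewrite invf_lt1 ?ltr1n ?ltr0n ?prime_gt1 ?prime_gt0.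
rewrite -/q -[RHS]/(formula q n mu).
(* [f e x] tests whether [x] is nonzero modulo [p ^ (mu - e)], so one ring serves for all exponents
   up to [mu]. *)
pose f e : R -> rat := fun x => (p%:R ^+ e * x != 0)%:R.
have f_inv e : unit_invariant (f e).
  by move=> u x uu; rewrite /f mulrCA (mulrI_eq0 _ (mulrI uu)).
have f0 e x : (mu <= e)%N -> f e x = 0.
  by rewrite /f -(Zp_pi_pow p_pr mu_gt0) => /eqP->; rewrite mul0r eqxx.
have avgf a e : avg a 0 (f e) = avg a a (f (e + a)%N).
  rewrite (avg_dead (Zp_nonunitP p_pr mu_gt0)).
  by apply: eq_avg => x; rewrite /f mulrA -exprD.
have avg_rec e k : avg k k (f e) = \sum_(c < k.+1) corank_law q k c * avg c c (f (e + c)%N).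
  rewrite -{1}[k]add0n.
  rewrite (corank_expansion q_gt0 q_lt1 (A := fun m n => avg m n (f e))).
    by apply: eq_bigr => c _; rewrite add0n avgf.
  move=> a b lba; rewrite (avgS (Zp_nonunitP p_pr mu_gt0)) //.
  by rewrite Zp_nonunit_ratio.
(* The coefficient of [X^e] is the probability for the modulus [p ^ (e + 1)]. *)
pose G k := series mu (fun e => avg k k (f (mu - e.+1)%N)).
have G0 : eqmodXn mu ((1 - 'X) * G 0%N) 1.
  move=> e le; rewrite -['X]scale1r series_mul1B // coef1.
  have av e' : avg 0 0 (f (mu - e'.+1)%N) = 1.
    by rewrite avg00 /f mulr1 (Zp_pi_pow p_pr mu_gt0); case: leqP => //; lia.
  by case: e le => [|e] le; rewrite !av ?subr0 // mul1r subrr.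
have hG k : eqmodXn mu (G k) (\sum_(c < k.+1) corank_law q k c *: ('X^c * G c)).
  move=> e le; rewrite coef_poly le avg_rec coef_sum; apply: eq_bigr => c _.
  (* If [e < c], the exponent [mu - e.+1 + c] is at least [mu] and the average is zero, as is the
     coefficient. *)
  rewrite coefZ coefXnM coef_poly; congr (_ * _); case: ltnP => ec.
    by rewrite -[RHS](avg0 R c c); apply: eq_avg => x; apply: f0; lia.
  rewrite (leq_ltn_trans (leq_subr _ _) le).
  by congr (avg _ _ (f _)); lia.
have h := truncated_series_numer q_gt0 q_lt1 G0 hG n.
have h' := eqmodXn_trans h (eqmodXn_sym (@formula_series q q_gt0 q_lt1 mu n)).
have {h'} : eqmodXn mu (G n) (series mu (fun e => formula q n e.+1)).
  have L0 : (lin_den q * quad_den q 0 n./2)`_0 != 0 by rewrite den_coef0 oner_neq0.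
  exact: (@eqmodXn_cancel mu _ _ _ L0 h').
(* The top coefficient, where [f] has index 0, is the probability sought. *)
move/(_ mu.-1); rewrite !coef_poly prednK // leqnn subnn => /(_ isT) <-.
exact: symP_avg.
Qed.
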